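(* Let $\mathcal H$ be an infinite-dimensional separable Hilbert space. There exists a frame for $\mathcal H$ consisting of vectors of norm one which has no subsequence (subfamily) that is a Riesz basis for $\mathcal H$.
   Context: A countable family $\{f_i\}_{i\in I}$ in $\mathcal H$ is a frame for $\mathcal H$ if there are $A,B>0$ with $A\|f\|^2\le\sum_{i\in I}|\langle f,f_i\rangle|^2\le B\|f\|^2$ for all $f\in\mathcal H$. A Riesz basis for $\mathcal H$ is a family which is the image of an orthonormal basis of $\mathcal H$ under a bounded invertible operator on $\mathcal H$. *)

(* Defs.v *)
From HB Require Import structures.
From mathcomp Require Import all_boot all_order all_algebra.
From mathcomp Require Import all_classical all_reals all_analysis.
From mathcomp Require Import complex.

Set Implicit Arguments.
Unset Strict Implicit.
Unset Printing Implicit Defensive.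

Import Order.TTheory GRing.Theory Num.Theory.
Import numFieldNormedType.Exports.

Local Open Scope classical_set_scope.
Local Open Scope ring_scope.

(* A Hilbert space over K is a complete normed module H together with a
   positive definite hermitian form dot (linear in its first argument and
   theta-linear in the second) inducing the norm of H. It is used with
   K = R, theta = idfun and with K = R[i], theta the complex conjugation. *)
Section HilbertSpaces.
Context {K : numFieldType} {theta : K -> K} {H : completeNormedModType K}.

Definition induces_norm (dot : {dot H for theta}) : Prop :=
  forall x : H, dot x x = `|x| ^+ 2.

(* Finite linear combinations: the v i need not be distinct, and n may be 0. *)
Definition linear_span (S : set H) : set H :=
  [set x | exists (n : nat) (c : 'I_n -> K) (v : 'I_n -> H),
    (forall i, S (v i)) /\ x = \sum_(i < n) c i *: v i].

Definition orthonormal_basis (dot : {dot H for theta}) (I : Type)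
    (e : I -> H) : Prop :=
  [/\ forall i, dot (e i) (e i) = 1,
      forall i j, i <> j -> dot (e i) (e j) = 0
    & closure (linear_span (range e)) = [set: H]].

Definition bounded_operator (T : H -> H) : Prop :=
  exists M : K, forall x, `|T x| <= M * `|x|.

(* Invertible in the algebra of bounded operators on H. *)
Definition bounded_invertible (T : {linear H -> H}) : Prop :=
  bounded_operator T /\
  exists S : {linear H -> H},
    [/\ bounded_operator S, cancel T S & cancel S T].

Definition riesz_basis (dot : {dot H for theta}) (I : Type)
    (f : I -> H) : Prop :=
  exists (e : I -> H) (T : {linear H -> H}),
    [/\ orthonormal_basis dot e, bounded_invertible T
      & forall i, f i = T (e i)].

End HilbertSpaces.

Definition infinite_dimensional {K : numFieldType}
    (H : completeNormedModType K) : Prop :=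
  ~ exists s : seq H, linear_span [set` s] = [set: H].

Definition separable {K : numFieldType} (H : completeNormedModType K) : Prop :=
  exists2 D : set H, countable D & dense D.

(* The norm of K takes its values in K itself; re : K -> R (the identity when
   K = R, the real part when K = R[i]) turns these values into elements of R,
   so that the sum can be taken in \bar R, where it always exists. *)
Definition frame {R : realType} {K : numFieldType} (re : K -> R)
    {theta : K -> K} {H : completeNormedModType K} (dot : {dot H for theta})
    (I : countType) (f : I -> H) : Prop :=
  exists A B : R, [/\ 0 < A, 0 < B &
    forall x : H,
      let S := (\esum_(i in [set: I]) ((re `|dot x (f i)|) ^+ 2)%:E)%E in
      ((A * (re `|x|) ^+ 2)%:E <= S)%E /\ (S <= (B * (re `|x|) ^+ 2)%:E)%E].

(* Main.v *)
Require Import Defs.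
From HB Require Import structures.
From mathcomp Require Import all_boot all_order all_algebra.
From mathcomp Require Import all_classical all_reals all_analysis.
From mathcomp Require Import complex.
From mathcomp Require Import ring lra.
Import Order.TTheory GRing.Theory Num.Theory.
Import numFieldNormedType.Exports.
Set Implicit Arguments.
Unset Strict Implicit.
Unset Printing Implicit Defensive.
Local Open Scope classical_set_scope.
Local Open Scope ring_scope.

(** The real and the complex case are treated together, over a field K with a
    conjugation theta such that a * theta a = |a|^2. Real numbers enter K through
    an order embedding iota, and re recovers a nonnegative element of K.

    Let (e (n, j)) be an orthonormal basis indexed by pairs, cut into blocks: the
    block n consists of the first n + 2 vectors e (n, j), with sum s_n and
    direction u_n = s_n / |s_n|. Replace each e (n, j) by its normalized component
    g (n, j) orthogonal to u_n, and add the vectors u_n themselves. This is the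
    unit-norm frame; the vectors e (n, j) beyond the block are orthogonal to u_n
    and stay unchanged.

    It is a frame because e (n, j) and its component orthogonal to u_n differ by
    <e (n, j), u_n> u_n. For fixed n these corrections contribute in total at most
    |<x, u_n>|^2, by Bessel's inequality for e, and the u_n are orthonormal. So the
    analysis sum of the new family and |x|^2 bound each other up to constants
    (deflated_lower, deflated_upper).

    It contains no Riesz basis because in every block the g (n, j), j < n + 2, sum
    to 0 (sum_block_frame). A Riesz basis J cannot omit two of them: if g (n, k)
    and g (n, l) are missing, then e (n, k) - e (n, l) is orthogonal to every
    vector of J (missing_two). So at least n + 1 of them are in J, and their sum
    has norm at most 1, being minus the sum of the at most one that is missing. The
    bounded operator that maps J back to an orthonormal family sends this sum to a
    vector of norm at least sqrt (n + 1). As n is arbitrary, no bound can hold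
    (riesz_bound_blocks). *)

(** * Inner products, finite orthonormal families and projections *)

Section InnerProduct.
Context {K : numFieldType} {theta : {rmorphism K -> K}}.
Context (thetaE : forall a, a * theta a = `|a| ^+ 2).
Context {H : completeNormedModType K} {dot : {dot H for theta}}.
Context (dotE : induces_norm dot).
Implicit Types (x y z : H) (a : K).

(** For a > 0, cancel a in a * theta a = |a|^2 = a * a. *)
Lemma theta_ge0 a : 0 <= a -> theta a = a.
Proof.
have [->|a0 age0] := eqVneq a 0; first by rewrite rmorph0.
by apply: (mulfI a0); rewrite thetaE ger0_norm // expr2.
Qed.

Lemma dotDl x y z : dot (x + y) z = dot x z + dot y z.
Proof. exact: (linearDl dot z x y). Qed.

Lemma dotBl x y z : dot (x - y) z = dot x z - dot y z.
Proof. exact: (linearBl dot z x y). Qed.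

Lemma dotZl a x z : dot (a *: x) z = a * dot x z.
Proof. exact: (linearZl_LR dot z a x). Qed.

Lemma dot_suml (I : Type) (s : seq I) (P : pred I) (F : I -> H) z :
  dot (\sum_(i <- s | P i) F i) z = \sum_(i <- s | P i) dot (F i) z.
Proof. exact: (linear_sumlz dot z s P F). Qed.

Lemma dotC x y : dot y x = theta (dot x y).
Proof. by rewrite hermC expr0 mul1r. Qed.

Lemma dotBr x y z : dot z (x - y) = dot z x - dot z y.
Proof. exact: (linearBr dot z x y). Qed.

Lemma dotZr a x z : dot z (a *: x) = theta a * dot z x.
Proof. exact: (linearZr_LR dot z a x). Qed.

Lemma dot_sumr (I : Type) (s : seq I) (P : pred I) (F : I -> H) z :
  dot z (\sum_(i <- s | P i) F i) = \sum_(i <- s | P i) dot z (F i).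
Proof. exact: (linear_sumr dot z s P F). Qed.

Lemma dot_eq0C x y : dot x y = 0 -> dot y x = 0.
Proof. by rewrite (dotC x y) => ->; rewrite rmorph0. Qed.

Lemma pythagoras x y : dot x y = 0 -> `|x + y| ^+ 2 = `|x| ^+ 2 + `|y| ^+ 2.
Proof. by rewrite -!dotE; exact: hnormDd. Qed.

Lemma ler_norm_orthogonal x y : dot x y = 0 -> `|x| <= `|x + y|.
Proof.
move=> xy0; rewrite -(ler_pXn2r (n := 2)) ?nnegrE // pythagoras //.
by rewrite lerDl exprn_ge0.
Qed.

Lemma combination_in_span (I : eqType) (S : set H) (s : seq I) (c : I -> K)
    (v : I -> H) :
  (forall i, i \in s -> S (v i)) -> linear_span S (\sum_(i <- s) c i *: v i).
Proof.
move=> Sv; exists (size s), (c \o tnth (in_tuple s)), (v \o tnth (in_tuple s)).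
by split=> [i|]; [apply: Sv; rewrite /= mem_tnth|rewrite big_tnth].
Qed.

Lemma orthogonal_span (S : set H) x y :
  (forall v, S v -> dot x v = 0) -> linear_span S y -> dot x y = 0.
Proof.
move=> xS [n [c [v [Sv ->]]]]; rewrite dot_sumr big1 // => i _.
by rewrite dotZr xS // mulr0.
Qed.

(** Allows the projection onto finitely many e i to be compared with an arbitrary
    approximation from the span of the whole family. *)
Lemma span_range_finite (I : choiceType) (e : I -> H) y :
  linear_span (range e) y ->
  exists2 s : seq I, uniq s & linear_span (e @` [set` s]) y.
Proof.
move=> [n [c [v [Sv ->]]]].
have /choice[t et] : forall k, exists i, e i = v k.
  by move=> k; have [i _ <-] := Sv k; exists i.
exists (undup [seq t k | k <- enum 'I_n]); first exact: undup_uniq.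
exists n, c, v; split => // k; exists (t k) => //=.
by rewrite mem_undup; apply: map_f; rewrite mem_enum.
Qed.

Section Projection.
Context {I : eqType} (e : I -> H).
Implicit Types (s : seq I).

Definition orthonormal_on s :=
  {in s &, forall i j, dot (e i) (e j) = (i == j)%:R}.

Definition oproj s x := \sum_(i <- s) dot x (e i) *: e i.

Lemma dot_combination s (c : I -> K) j : uniq s -> orthonormal_on s -> j \in s ->
  dot (\sum_(i <- s) c i *: e i) (e j) = c j.
Proof.
move=> us os js; rewrite dot_suml (bigD1_seq j) //= dotZl os // eqxx mulr1.
rewrite big_seq_cond big1 ?addr0 // => i /andP[si ij].
by rewrite dotZl os // (negPf ij) mulr0.
Qed.

Lemma norm_combination s (c : I -> K) : uniq s -> orthonormal_on s ->
  `|\sum_(i <- s) c i *: e i| ^+ 2 = \sum_(i <- s) `|c i| ^+ 2.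
Proof.
move=> us os; rewrite -dotE {2}[\sum_(i <- s) _]big_seq dot_sumr [RHS]big_seq.
apply: eq_bigr => j js.
by rewrite dotZr dot_combination // mulrC thetaE.
Qed.

Lemma dot_residual s x i : uniq s -> orthonormal_on s -> i \in s ->
  dot (x - oproj s x) (e i) = 0.
Proof. by move=> us os si; rewrite dotBl dot_combination // subrr. Qed.

Lemma residual_orthogonal s x (c : I -> K) : uniq s -> orthonormal_on s ->
  dot (x - oproj s x) (\sum_(i <- s) c i *: e i) = 0.
Proof.
move=> us os; rewrite dot_sumr big_seq big1 // => i si.
by rewrite dotZr dot_residual // mulr0.
Qed.

(** The projection and the residual are orthogonal, so this is the Pythagorean
    theorem; it yields both Bessel's inequality and Parseval's identity. *)
Lemma bessel_eq s x : uniq s -> orthonormal_on s ->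
  `|x| ^+ 2 = \sum_(i <- s) `|dot x (e i)| ^+ 2 + `|x - oproj s x| ^+ 2.
Proof.
move=> us os; rewrite -norm_combination // -/(oproj s x) addrC -pythagoras.
  by rewrite subrK.
exact: residual_orthogonal.
Qed.

Lemma bessel_ineq s x : uniq s -> orthonormal_on s ->
  \sum_(i <- s) `|dot x (e i)| ^+ 2 <= `|x| ^+ 2.
Proof. by move=> us os; rewrite [leRHS](bessel_eq _ us os) lerDl exprn_ge0. Qed.

Lemma oproj_in_span s x : linear_span (e @` [set` s]) (oproj s x).
Proof. by apply: combination_in_span => i si; exists i. Qed.

(** The residual is orthogonal to the span, hence to the difference between the
    projection and y. *)
Lemma oproj_best s x y : uniq s -> orthonormal_on s ->
  linear_span (e @` [set` s]) y -> `|x - oproj s x| <= `|x - y|.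
Proof.
move=> us os sy.
have -> : x - y = (x - oproj s x) + (oproj s x - y) by rewrite addrA subrK.
have ro y' : linear_span (e @` [set` s]) y' -> dot (x - oproj s x) y' = 0.
  by apply: orthogonal_span => _ [i /= si <-]; exact: dot_residual.
by apply: ler_norm_orthogonal; rewrite dotBr !ro ?subrr //; exact: oproj_in_span.
Qed.

End Projection.

End InnerProduct.

(** * Gram-Schmidt orthonormalization of a dense sequence *)

Section GramSchmidt.
Context {K : numFieldType} {theta : {rmorphism K -> K}}.
Context (thetaE : forall a, a * theta a = `|a| ^+ 2).
Context {H : completeNormedModType K} {dot : {dot H for theta}}.
Context (dotE : induces_norm dot).
Implicit Types (x y z : H) (a : K) (L : seq H).

Local Notation projL := (oproj (dot := dot) id).
Local Notation orthonormal_list L :=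
  (uniq L /\ orthonormal_on (dot := dot) id L).

(** Membership in the closed span of S; eps lives in K, where the norm takes its
    values. *)
Definition approximable (S : set H) x :=
  forall eps : K, 0 < eps -> exists2 y, linear_span S y & `|x - y| < eps.

(** A finite-dimensional span is closed: by minimality of the projection, a
    nonzero residual bounds the distance to the span from below. *)
Lemma approximable_seq L x : orthonormal_list L ->
  approximable [set` L] x -> x = projL L x.
Proof.
move=> [uL oL] appr; apply/eqP; rewrite -subr_eq0 -normr_eq0.
apply/negPn/negP => r0.
have n0 : 0 < `|x - projL L x| by rewrite lt_def r0 normr_ge0.
have [y Ly /lt_geF/negP[]] := appr _ n0.
by apply: (oproj_best dotE) => //; rewrite image_id.
Qed.

(** A vector that already lies in the span of L is dropped, so that every list
    produced consists of unit vectors. *)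
Definition gs_step L x :=
  let r := x - projL L x in if r == 0 then L else rcons L (`|r|^-1 *: r).

Lemma gs_step_sub L x v : v \in L -> v \in gs_step L x.
Proof.
by rewrite /gs_step; case: ifP => // _ vL; rewrite mem_rcons inE vL orbT.
Qed.

Lemma gs_step_orthonormal L x : orthonormal_list L -> orthonormal_list (gs_step L x).
Proof.
move=> [uL oL]; rewrite /gs_step; case: eqVneq => // r0.
set r := x - _ in r0 *; set w := _ *: r.
have wL v : v \in L -> dot w v = 0.
  by move=> vL; rewrite dotZl (dot_residual _ uL oL vL) mulr0.
have n0 : `|r| != 0 by rewrite normr_eq0.
have ww : dot w w = 1.
  by rewrite dotE normrZ normfV normr_id mulVf // expr1n.
have wNL : w \notin L.
  by apply/negP => /wL; rewrite ww => /eqP; rewrite oner_eq0.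
split; first by rewrite rcons_uniq wNL.
move=> u v; rewrite !mem_rcons !inE => /predU1P[->|uL'] /predU1P[->|vL].
- by rewrite ww eqxx.
- by rewrite wL // eq_sym (negPf (memPn wNL _ vL)).
- by rewrite (dot_eq0C (wL _ uL')) (negPf (memPn wNL _ uL')).
- exact: oL.
Qed.

Lemma gs_step_span L x : orthonormal_list L -> linear_span [set` gs_step L x] x.
Proof.
move=> oL; have [[uL _] [uL' oL']] := (oL, gs_step_orthonormal x oL).
suff {2}-> : x = projL (gs_step L x) x by apply: combination_in_span.
move: uL' oL'; rewrite /gs_step; case: eqVneq => [r0 _ _|r0 uL' oL'].
  by apply/eqP; rewrite -subr_eq0 r0.
have n0 : `|x - projL L x| != 0 by rewrite normr_eq0.
set r := x - _ in r0 n0 uL' oL' *.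
apply/eqP; rewrite /oproj -cats1 big_cat big_seq1 -/(projL L x) /= addrC -subr_eq -/r.
rewrite -{1}(subrK (projL L x) x) -/r.
have rp : dot r (projL L x) = 0.
  apply: (orthogonal_span (S := id @` [set` L])); last exact: oproj_in_span.
  by move=> _ [v /= vL <-]; apply: dot_residual; case: oL.
have -> : dot (r + projL L x) (`|r|^-1 *: r) = `|r|.
  rewrite dotZr dotDl (dot_eq0C rp) addr0.
  by rewrite dotE (theta_ge0 thetaE) ?invr_ge0 // expr2 mulKf.
by rewrite scalerA mulfV // scale1r.
Qed.

Section Sequence.
Context (d : nat -> H).

Fixpoint gs_list n := if n is k.+1 then gs_step (gs_list k) (d k) else [::].

Lemma gs_list_orthonormal n : orthonormal_list (gs_list n).
Proof. by elim: n => [|n IHn]; [split|exact: gs_step_orthonormal]. Qed.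

Lemma gs_list_sub m n : (m <= n)%N -> {subset gs_list m <= gs_list n}.
Proof.
move=> /subnK <-; elim: (n - m)%N => [|k IHk] v // /IHk vk.
by exact: gs_step_sub.
Qed.

Definition gs_set : set H := [set v | exists n, v \in gs_list n].

Lemma gs_set_orthonormal v w : gs_set v -> gs_set w -> dot v w = (v == w)%:R.
Proof.
move=> [m vm] [n wn]; have [_] := gs_list_orthonormal (maxn m n); apply.
  by move: vm; apply: gs_list_sub; rewrite leq_maxl.
by move: wn; apply: gs_list_sub; rewrite leq_maxr.
Qed.

Lemma gs_set_countable : countable gs_set.
Proof.
have -> : gs_set = \bigcup_n [set` gs_list n].
  by apply/seteqP; split=> v; [move=> [n vn]; exists n|move=> [n _ vn]; exists n].
by apply: bigcup_countable => // n _; apply: finite_set_countable.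
Qed.

Lemma gs_set_span n : linear_span gs_set (d n).
Proof.
have := gs_step_span (d n) (gs_list_orthonormal n).
move=> [k [c [v [vL ->]]]].
by exists k, c, v; split => // i; exists n.+1; exact: vL.
Qed.

End Sequence.

(** A countable dense set comes with an injection into nat; inverting it, with
    junk value 0 outside its image, enumerates the set. *)
Lemma separable_sequence : separable H ->
  exists d : nat -> H, forall x (eps : K), 0 < eps -> exists n, `|x - d n| < eps.
Proof.
move=> [D Dc Dd]; have [f finj] : exists f : H -> nat, {in D &, injective f}.
  by move: Dc => /countable_injP.
exists (fun n => xget 0 [set x | D x /\ f x = n]) => x eps eps0.
have [y [+ Dy]] : ball x eps `&` D !=set0.
  by apply: Dd; [exists x; exact: ballxx|exact: ball_open].
rewrite -ball_normE /= => xy; exists (f y).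
case: xgetP => [z _ [Dz fz]|/(_ y)[]//].
by rewrite (finj z y) ?inE.
Qed.

(** The Gram-Schmidt vectors of a dense sequence form a countable orthonormal set
    with dense span. If this set were finite, its span would be closed, hence all
    of H; so it is in bijection with nat * nat. *)
Lemma orthonormal_basis_pairs : separable H -> infinite_dimensional H ->
  exists e : nat * nat -> H,
    (forall i j, dot (e i) (e j) = (i == j)%:R) /\
    forall x, approximable (range e) x.
Proof.
move=> /separable_sequence[d dd] Hinf; set E := gs_set d.
have appr x : approximable E x.
  move=> eps /(dd x)[n xn]; exists (d n) => //; exact: gs_set_span.
have Einf : infinite_set E.
  move=> /finite_seqP[s Es]; apply: Hinf; exists (undup s).
  apply/seteqP; split=> // x _.
  have EE : E = [set` undup s].
    by rewrite Es; apply/seteqP; split=> v /=; rewrite mem_undup.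
  suff -> : x = projL (undup s) x by apply: combination_in_span.
  apply: approximable_seq; last by rewrite -EE.
  split; first exact: undup_uniq.
  move=> v w; rewrite !mem_undup => vs ws.
  by apply: (@gs_set_orthonormal d); rewrite -/E Es.
have /card_set_bijP[e [eE einj esurj]] : ([set: nat * nat] #= E)%card.
  apply: card_eq_trans (card_nat2) _; apply/card_esym/eq_card_nat => //.
  exact: gs_set_countable.
exists e; split => [i j|x].
  rewrite (gs_set_orthonormal (d := d)); [|exact: eE|exact: eE].
  by rewrite (inj_eq (f := e)) // => a b; apply: einj; rewrite inE.
suff -> : range e = E by exact: appr.
by apply/seteqP; split=> [_ [i _ <-]|v /esurj[i _ <-]]; [exact: eE|exists i].
Qed.

End GramSchmidt.

(** * Bessel, Parseval and the deflated frame *)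

Section Frames.
Context {R : realType} {K : numFieldType} {theta : {rmorphism K -> K}}.
Context (thetaE : forall a, a * theta a = `|a| ^+ 2).
Context (iota : {rmorphism R -> K}) (iota_le : {mono iota : r s / r <= s}).
Context (re : K -> R) (reK : forall a, 0 <= a -> iota (re a) = a).
Context {H : completeNormedModType K} {dot : {dot H for theta}}.
Context (dotE : induces_norm dot).
Implicit Types (x y z : H) (a b : K).

Lemma re_ge0 a : 0 <= a -> 0 <= re a.
Proof. by move=> a0; rewrite -iota_le rmorph0 reK. Qed.

Lemma iota_re_sqr a : 0 <= a -> iota ((re a) ^+ 2) = a ^+ 2.
Proof. by move=> a0; rewrite rmorphXn reK. Qed.

(** The bound 2|a|^2 + 2|b|^2, written without products so that it can be summed
    termwise in the extended reals. *)
Lemma re_normB_sqr a b :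
  (re `|a - b|) ^+ 2 <= ((re `|a|) ^+ 2 + (re `|b|) ^+ 2)
                      + ((re `|a|) ^+ 2 + (re `|b|) ^+ 2).
Proof.
have le_ab : re `|a - b| <= re `|a| + re `|b|.
  by rewrite -iota_le rmorphD !reK // ler_normB.
apply: (@le_trans _ _ ((re `|a| + re `|b|) ^+ 2)).
  by rewrite ler_pXn2r // nnegrE ?addr_ge0 ?re_ge0.
rewrite -subr_ge0; apply: le_trans (sqr_ge0 (re `|a| - re `|b|)) _.
by rewrite le_eqVlt; apply/orP; left; apply/eqP; ring.
Qed.

Definition orthonormal_family (I : eqType) (e : I -> H) :=
  forall i j, dot (e i) (e j) = (i == j)%:R.

Lemma orthonormal_family_norm (I : eqType) (e : I -> H) i :
  orthonormal_family e -> `|e i| = 1.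
Proof.
move=> oe; apply/eqP; rewrite -(eqrXn2 (n := 2)) //.
by rewrite -dotE oe eqxx expr1n.
Qed.

Lemma bessel_esum (I : choiceType) (e : I -> H) x : orthonormal_family e ->
  (\esum_(i in [set: I]) ((re `|dot x (e i)|) ^+ 2)%:E <= ((re `|x|) ^+ 2)%:E)%E.
Proof.
move=> oe; apply: ge_ereal_sup => /= _ [X [finX _] <-].
rewrite fsbig_finite //= sumEFin lee_fin -iota_le rmorph_sum /= iota_re_sqr //.
under eq_bigr do rewrite iota_re_sqr //.
by apply: (bessel_ineq thetaE dotE) => // i j _ _; exact: oe.
Qed.

(** Within eps, |x|^2 is already reached by finitely many coefficients: those of
    the e i that occur in a combination at distance less than sqrt eps from x. *)
Lemma parseval_esum (I : choiceType) (e : I -> H) x :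
  orthonormal_family e -> approximable (range e) x ->
  (((re `|x|) ^+ 2)%:E <= \esum_(i in [set: I]) ((re `|dot x (e i)|) ^+ 2)%:E)%E.
Proof.
move=> oe appr; apply/lee_addgt0Pr => eps eps0.
have [|y /span_range_finite[s us sy] xy] := appr (iota (Num.sqrt eps)).
  by rewrite -(rmorph0 iota) (leW_mono iota_le) sqrtr_gt0.
rewrite -leeBlDr // -EFinB; apply: esum_ge; exists [set` s].
  by split=> //; exact: finite_seq.
rewrite -fsbig_seq // sumEFin lee_fin lerBlDr -iota_le rmorphD rmorph_sum /=.
under eq_bigr do rewrite iota_re_sqr //.
have os : orthonormal_on (dot := dot) e s by move=> i j _ _; exact: oe.
rewrite iota_re_sqr // (bessel_eq thetaE dotE x us os) lerD2l.
rewrite -(sqr_sqrtr (ltW eps0)) rmorphXn ler_pXn2r ?nnegrE //.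
  exact: le_trans (oproj_best dotE x us os sy) (ltW xy).
by rewrite -(rmorph0 iota) iota_le.
Qed.

Section DeflatedFrame.
Context (e : nat * nat -> H) (u : nat -> H).
Context (oe : orthonormal_family e) (ou : orthonormal_family u).
Context (approx_e : forall x, approximable (range e) x).
Context (half : forall i, `|dot (e i) (u i.1)| ^+ 2 <= 2^-1).

(** The component of e i orthogonal to the direction assigned to its block, which
    is the first coordinate of i. *)
Definition deflated i := e i - dot (e i) (u i.1) *: u i.1.

Definition deflated_frame (i : nat + nat * nat) : H :=
  match i with
  | inl n => u n
  | inr p => `|deflated p|^-1 *: deflated p
  end.

(** e i is the orthogonal sum of its deflation and of its component along u. *)
Lemma norm_deflated i : `|deflated i| ^+ 2 = 1 - `|dot (e i) (u i.1)| ^+ 2.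
Proof.
have := @pythagoras _ _ _ _ dotE (deflated i) (dot (e i) (u i.1) *: u i.1).
rewrite {2}/deflated subrK !normrZ (orthonormal_family_norm _ oe).
rewrite (orthonormal_family_norm _ ou) mulr1 expr1n => -> //.
  by rewrite addrK.
by rewrite dotZr /deflated dotBl dotZl ou eqxx mulr1 subrr mulr0.
Qed.

Lemma norm_deflated_ge i : 2^-1 <= `|deflated i| ^+ 2.
Proof.
rewrite norm_deflated lerBrDr; apply: le_trans (lerD (lexx _) (half i)) _.
by rewrite -div1r -splitr.
Qed.

Lemma norm_deflated_le i : `|deflated i| ^+ 2 <= 1.
Proof. by rewrite norm_deflated gerBl exprn_ge0. Qed.

Lemma norm_deflated_gt0 i : 0 < `|deflated i| ^+ 2.
Proof. by apply: lt_le_trans (norm_deflated_ge i). Qed.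

Lemma deflated_frame_norm i : `|deflated_frame i| = 1.
Proof.
case: i => [n|p] /=; first exact: orthonormal_family_norm ou.
rewrite normrZ normfV normr_id mulVf // normr_eq0 -normr_eq0.
by have := norm_deflated_gt0 p; rewrite lt_def sqrf_eq0 => /andP[].
Qed.

Section Estimates.
Context (x : H).
(* W i is the squared size of the correction made at index i when e i is deflated. *)
Let A i := (re `|dot x (e i)|) ^+ 2.
Let G i := (re `|dot x (deflated_frame (inr i))|) ^+ 2.
Let U n := (re `|dot x (u n)|) ^+ 2.
Let D i := (re `|dot x (deflated i)|) ^+ 2.
Let W i := (re `|dot (dot x (u i.1) *: u i.1) (e i)|) ^+ 2.

Lemma dot_deflated i :
  dot x (deflated i) = dot x (e i) - dot (dot x (u i.1) *: u i.1) (e i).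
Proof. by rewrite dotBr dotZr dotZl (dotC (e i) (u _)) mulrC. Qed.

Let AW i : A i <= (D i + W i) + (D i + W i).
Proof.
have -> : A i = (re `|dot x (deflated i) - (- dot (dot x (u i.1) *: u i.1) (e i))|) ^+ 2.
  by rewrite dot_deflated opprK subrK.
by apply: le_trans (re_normB_sqr _ _) _; rewrite normrN.
Qed.

Let DW i : D i <= (A i + W i) + (A i + W i).
Proof. by rewrite /D dot_deflated; exact: re_normB_sqr. Qed.

Let iotaG i : iota (G i) * `|deflated i| ^+ 2 = iota (D i).
Proof.
rewrite /G /D !iota_re_sqr //= dotZr (theta_ge0 thetaE) ?invr_ge0 //.
rewrite normrM normfV normr_id exprMn mulrAC -exprMn mulVf ?expr1n ?mul1r //.
by have := norm_deflated_gt0 i; rewrite lt_def sqrf_eq0 => /andP[].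
Qed.

Let DG i : D i <= G i.
Proof.
rewrite -iota_le -iotaG ler_piMr ?norm_deflated_le //.
by rewrite -(rmorph0 iota) iota_le sqr_ge0.
Qed.

Let GD i : G i <= D i + D i.
Proof.
rewrite -iota_le rmorphD -iotaG -mulrDr ler_peMr //.
  by rewrite -(rmorph0 iota) iota_le sqr_ge0.
rewrite (splitr 1) div1r; apply: lerD; exact: norm_deflated_ge.
Qed.

Local Open Scope ereal_scope.

(* On each block, this is Bessel's inequality for e, applied to the component of x
   along u n. *)
Let esumW : \esum_(i in [set: nat * nat]) (W i)%:E <= \esum_(n in [set: nat]) (U n)%:E.
Proof.
have -> : [set: nat * nat] = [set: nat] `*`` (fun=> [set: nat]).
  by apply/seteqP; split.
rewrite (eq_esum (b := fun k => (W (k.1, k.2))%:E)); last by case.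
rewrite -(@esum_esum _ _ _ _ _ (fun n j => (W (n, j))%:E)); last first.
  by move=> *; rewrite lee_fin sqr_ge0.
apply: le_esum => n _.
have -> : U n = ((re `|dot x (u n) *: u n|) ^+ 2)%R.
  by rewrite normrZ (orthonormal_family_norm _ ou) mulr1.
have on : orthonormal_family (fun j => e (n, j)).
  by move=> i j; rewrite oe xpair_eqE eqxx.
by rewrite /W /=; exact: (bessel_esum _ on).
Qed.

Let S := \esum_(i in [set: nat + nat * nat])
  ((re `|dot x (deflated_frame i)|) ^+ 2)%:E.

Let S_split : S = \esum_(n in [set: nat]) (U n)%:E + \esum_(i in [set: nat * nat]) (G i)%:E.
Proof.
rewrite /S (esumID (range inl)); last by move=> *; rewrite lee_fin sqr_ge0.
rewrite !setTI; congr (_ + _).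
  by rewrite esum_image // => a b _ _ [].
have -> : ~` range (@inl nat (nat * nat)) = range inr.
  apply/seteqP; split=> [[n /(_ _)[]|p _]|_ [p _ <-] [n _] //].
    by exists n.
  by exists p.
by rewrite esum_image // => a b _ _ [].
Qed.

(** Parseval's identity expresses |x|^2 by the A i, and A i <= 2 G i + 2 W i. *)
Lemma deflated_lower : ((2^-1 * (re `|x|) ^+ 2)%:E <= S).
Proof.
have xS : ((re `|x|) ^+ 2)%:E <= S + S.
  apply: le_trans (parseval_esum oe (approx_e x)) _.
  apply: (@le_trans _ _ (\esum_(i in [set: nat * nat])
      (((G i)%:E + (W i)%:E) + ((G i)%:E + (W i)%:E)))).
    apply: le_esum => i _; rewrite lee_fin; apply: le_trans (AW i) _.
    by rewrite !lerD // ?DG.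
  rewrite !esumD; do ?by move=> *; rewrite ?adde_ge0 // lee_fin sqr_ge0.
  by rewrite S_split addeC; apply: leeD; rewrite addeC; apply: leeD2r.
have : 0 <= S by apply: esum_ge0 => *; rewrite lee_fin sqr_ge0.
case: S xS => [s xs _|_ _|_ //]; last by rewrite leey.
by move: xs; rewrite -EFinD !lee_fin => xs; lra.
Qed.

(** G i <= 2 D i <= 4 A i + 4 W i bounds the sum of the G i by 8 |x|^2, and the
    u n contribute at most |x|^2. *)
Lemma deflated_upper : S <= (9 * (re `|x|) ^+ 2)%:E.
Proof.
set X := ((re `|x|) ^+ 2)%R.
have UX : \esum_(n in [set: nat]) (U n)%:E <= X%:E by exact: bessel_esum.
have AX : \esum_(i in [set: nat * nat]) (A i)%:E <= X%:E by exact: bessel_esum.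
have WX := le_trans esumW UX.
rewrite S_split.
have GX : \esum_(i in [set: nat * nat]) (G i)%:E <= (8 * X)%:E.
  apply: (@le_trans _ _ (\esum_(i in [set: nat * nat])
     ((((A i)%:E + (W i)%:E) + ((A i)%:E + (W i)%:E))
    + (((A i)%:E + (W i)%:E) + ((A i)%:E + (W i)%:E))))).
    apply: le_esum => i _; rewrite lee_fin; apply: le_trans (GD i) _.
    by rewrite lerD // ?DW.
  rewrite !esumD; do ?by move=> *; rewrite ?adde_ge0 // lee_fin sqr_ge0.
  have -> : (8 * X)%:E = (X%:E + X%:E + (X%:E + X%:E)) + (X%:E + X%:E + (X%:E + X%:E)).
    by rewrite -!EFinD; congr EFin; ring.
  by rewrite !leeD.
have -> : (9 * X)%:E = X%:E + (8 * X)%:E by rewrite -EFinD; congr EFin; ring.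
exact: leeD.
Qed.

End Estimates.

Lemma deflated_frame_frame : frame re dot deflated_frame.
Proof.
exists 2^-1, 9; split=> // x S; split; [exact: deflated_lower|exact: deflated_upper].
Qed.

End DeflatedFrame.
End Frames.

(** * The deflated frame contains no Riesz basis *)

Section NoRieszSubfamily.
Context {K : numFieldType} {theta : {rmorphism K -> K}}.
Context (thetaE : forall a, a * theta a = `|a| ^+ 2).
Context {H : completeNormedModType K} {dot : {dot H for theta}}.
Context (dotE : induces_norm dot).
Implicit Types (x y z : H) (a b : K).

Lemma closure_approximable (S : set H) x : closure (linear_span S) x -> approximable S x.
Proof.
move=> clx eps eps0; have [|y [Sy xy]] := clx (ball x eps).
  exact: nbhsx_ballx.
by exists y => //; move: xy; rewrite -ball_normE.
Qed.

(** What is used of a Riesz basis: S is the inverse of the operator that produces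
    it, so it is bounded and turns the basis back into an orthonormal family. The
    basis is total: a vector y orthogonal to it satisfies |y| <= |y - T w| for all w
    in the span of the orthonormal basis, while T w can be made close to y. *)
Lemma riesz_subfamily (I : choiceType) (f : I -> H) (J : set I) :
  riesz_basis dot (fun j : J => f (\val j)) ->
  exists (S : {linear H -> H}) (M : K),
    [/\ forall x, `|S x| <= M * `|x|,
        forall i j, J i -> J j -> dot (S (f i)) (S (f j)) = (i == j)%:R
      & forall y, (forall i, J i -> dot y (f i) = 0) -> y = 0].
Proof.
move=> [e [T [[e1 e0 etot] [[MT boundT] [S [[MS boundS] TS ST]]] fT]]].
exists S, MS; split => // [i j Ji Jj|y yJ].
  have Sf k (Jk : J k) : S (f k) = e (SigSub (mem_set Jk)) by rewrite -(TS (e _)) -fT.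
  rewrite !Sf; have [ij|ij] := eqVneq i j.
    rewrite -[RHS](e1 (SigSub (mem_set Ji))); congr (dot _ (e _)).
    exact/val_inj.
  by rewrite e0 // => /(congr1 val)/= /eqP; rewrite (negPf ij).
apply/eqP/negPn/negP => y0.
have ygt0 : 0 < `|y| by rewrite normr_gt0.
(* A bound is only an element of K; the nonzero value y of T makes it positive. *)
have MT0 : 0 < MT.
  have : 0 < MT * `|S y| by apply: lt_le_trans (boundT _); rewrite ST.
  by rewrite pmulr_lgt0 // normr_gt0; apply: contra_neq y0 => Sy0; rewrite -(ST y) Sy0 linear0.
have appr : approximable (range e) (S y).
  by apply: closure_approximable; rewrite etot.
have [|w [n [c [v [ve wE]]]] yw] := appr (`|y| / MT); first by rewrite divr_gt0.
have yTw : dot y (T w) = 0.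
  rewrite wE linear_sum dot_sumr big1 // => k _; have [j _ <-] := ve k.
  by rewrite linearZ dotZr -fT yJ ?mulr0 //; exact: set_mem (valP j).
have : `|y| <= `|y - T w|.
  apply: (ler_norm_orthogonal dotE).
  by rewrite -scaleN1r dotZr yTw mulr0.
rewrite -{2}(ST y) -linearB => /le_trans/(_ (boundT _)).
by rewrite mulrC -ler_pdivrMr // => /le_lt_trans/(_ yw); rewrite ltxx.
Qed.

Section Blocks.
Context (e : nat * nat -> H) (oe : orthonormal_family (dot := dot) e).

Definition block_sum n := \sum_(j < n.+2) e (n, val j).

Definition block_dir n := `|block_sum n|^-1 *: block_sum n.

Lemma dot_block_sum i n :
  dot (e i) (block_sum n) = ((i.1 == n) && (i.2 < n.+2)%N)%:R.
Proof.
case: i => m j /=; rewrite dot_sumr.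
under eq_bigr do rewrite oe xpair_eqE.
case: eqVneq => _ /=; last by rewrite big1.
case: ltnP => jn; last first.
  by rewrite big1 // => k _; rewrite gtn_eqF // (leq_trans _ jn).
rewrite (bigD1 (Ordinal jn)) //= eqxx big1 ?addr0 // => k kj.
by rewrite eq_sym; move: kj; rewrite -val_eqE /= => /negPf->.
Qed.

Lemma dot_block_sums m n :
  dot (block_sum m) (block_sum n) = (m == n)%:R * m.+2%:R.
Proof.
rewrite {1}/block_sum dot_suml; under eq_bigr do rewrite dot_block_sum /=.
case: eqVneq => [->|_] /=; last by rewrite big1 ?mul0r.
under eq_bigr do rewrite ltn_ord.
by rewrite sumr_const card_ord mul1r.
Qed.

Lemma norm_block_sum n : `|block_sum n| ^+ 2 = n.+2%:R.
Proof. by rewrite -dotE dot_block_sums eqxx mul1r. Qed.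

Lemma norm_block_sum_neq0 n : `|block_sum n| != 0.
Proof. by rewrite -sqrf_eq0 norm_block_sum pnatr_eq0. Qed.

Lemma dot_block_dir x n : dot x (block_dir n) = `|block_sum n|^-1 * dot x (block_sum n).
Proof. by rewrite dotZr (theta_ge0 thetaE) // invr_ge0. Qed.

Lemma block_dir_orthonormal : orthonormal_family (dot := dot) block_dir.
Proof.
move=> m n; rewrite dot_block_dir dotZl dot_block_sums.
case: eqVneq => [->|_]; last by rewrite mul0r !mulr0.
by rewrite mul1r -norm_block_sum expr2 mulKf ?mulVf ?norm_block_sum_neq0.
Qed.

Lemma coef_block_dir i :
  `|dot (e i) (block_dir i.1)| ^+ 2 = (i.2 < i.1.+2)%N%:R / i.1.+2%:R.
Proof.
rewrite dot_block_dir dot_block_sum eqxx /= normrM normfV normr_id exprMn exprVn.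
by rewrite norm_block_sum mulrC normr_nat; case: (_ < _)%N; rewrite ?expr1n ?expr0n.
Qed.

(** Blocks start at size 2 precisely for this bound, which keeps the deflated
    vectors away from 0. *)
Lemma coef_block_dir_half i : `|dot (e i) (block_dir i.1)| ^+ 2 <= 2^-1.
Proof.
rewrite coef_block_dir; case: (_ < _)%N; last by rewrite mul0r invr_ge0.
by rewrite mul1r lef_pV2 ?posrE // ler_nat.
Qed.

Local Notation g i := (deflated_frame (dot := dot) e block_dir (inr i)).

(** s_n is a multiple of u_n, so nothing of it is left orthogonally to u_n. *)
Lemma sum_block_deflated n : \sum_(j < n.+2) deflated (dot := dot) e block_dir (n, val j) = 0.
Proof.
transitivity (block_sum n - dot (block_sum n) (block_dir n) *: block_dir n).
  by rewrite [in X in dot X]/block_sum dot_suml scaler_suml -sumrB.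
rewrite dot_block_dir dot_block_sums eqxx mul1r -norm_block_sum expr2.
by rewrite mulKf ?norm_block_sum_neq0 // scalerA divff ?norm_block_sum_neq0 // scale1r subrr.
Qed.

(** The deflated vectors of one block all have the same norm, so normalizing them
    preserves the linear relation. *)
Lemma sum_block_frame n : \sum_(j < n.+2) g (n, val j) = 0.
Proof.
have nE (j : 'I_n.+2) : `|deflated (dot := dot) e block_dir (n, val j)|
    = `|deflated (dot := dot) e block_dir (n, 0%N)|.
  apply/eqP; rewrite -(eqrXn2 (n := 2)) //.
  rewrite !(norm_deflated dotE oe block_dir_orthonormal).
  by rewrite !coef_block_dir /= ltn_ord.
under eq_bigr => j _ do rewrite /deflated_frame nE.
by rewrite -scaler_sumr sum_block_deflated scaler0.
Qed.

(** The difference is orthogonal to u_n, since the two basis vectors have the same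
    coefficient on it; deflating by u_n thus leaves its products with the e i
    unchanged. *)
Lemma missing_two n (k l : nat) (J : set (nat + nat * nat)) :
  (k < n.+2)%N -> (l < n.+2)%N -> ~ J (inr (n, k)) -> ~ J (inr (n, l)) ->
  forall i, J i -> dot (e (n, k) - e (n, l)) (deflated_frame (dot := dot) e block_dir i) = 0.
Proof.
move=> kn ln Jk Jl.
have yu m : dot (e (n, k) - e (n, l)) (block_dir m) = 0.
  rewrite dot_block_dir dotBl !dot_block_sum /=.
  by case: eqVneq => [<-|_]; rewrite ?kn ?ln subrr mulr0.
case=> [m _|p Jp]; first exact: yu.
suff y0 : dot (e (n, k) - e (n, l)) (deflated (dot := dot) e block_dir p) = 0.
  by rewrite /= dotZr y0 mulr0.
rewrite /deflated dotBr dotZr yu mulr0 subr0.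
rewrite dotBl !oe; case: eqVneq => [kp|_]; first by rewrite kp in Jk.
by case: eqVneq => [lp|_]; [rewrite lp in Jl|rewrite subrr].
Qed.

(** By missing_two, J keeps at least n + 1 vectors g (n, k) of the block n and omits
    at most one. Those kept sum to minus those omitted, a vector of norm at most 1,
    which S sends to a vector whose squared norm is the number of those kept. *)
Lemma riesz_bound_blocks (J : set (nat + nat * nat)) :
  riesz_basis dot (fun j : J => deflated_frame (dot := dot) e block_dir (\val j)) ->
  exists2 M : K, 0 <= M & forall n, n.+1%:R <= M ^+ 2.
Proof.
move=> /riesz_subfamily[S [M [boundS oS tot]]].
have gn := deflated_frame_norm dotE oe block_dir_orthonormal coef_block_dir_half.
have M0 : 0 <= M.
  by have := boundS (block_dir 0%N); rewrite (gn (inl 0%N)) mulr1; exact: le_trans.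
exists M => // n.
pose B := [pred k : 'I_n.+2 | `[< J (inr (n, val k)) >]].
have missing_le1 : (#|[predC B]| <= 1)%N.
  apply/card_le1_eqP => k l; rewrite !inE => /asboolPn Jk /asboolPn Jl.
  apply/eqP/negPn/negP => kl.
  have := congr1 (dot^~ (e (n, val k))) (tot _ (missing_two (ltn_ord k) (ltn_ord l) Jk Jl)).
  rewrite dotBl !oe eqxx xpair_eqE eqxx /= (inj_eq val_inj) (negPf kl) subr0.
  by rewrite (linear0l dot) => /eqP; rewrite oner_eq0.
have present_ge : (n.+1 <= #|B|)%N.
  have := cardC B; rewrite card_ord => cB.
  by rewrite -(leq_add2r #|[predC B]|) cB -[leqRHS]addn1 leq_add2l.
pose z := \sum_(k | B k) g (n, val k).
have zle : `|z| <= 1.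
  have /eqP := sum_block_frame n; rewrite (bigID B) /= -/z addr_eq0 => /eqP->.
  rewrite normrN; apply: le_trans (ler_norm_sum _ _ _) _.
  apply: (@le_trans _ _ (\sum_(k : 'I_n.+2 | ~~ B k) 1)).
    by apply: ler_sum => k _; rewrite (gn (inr (n, val k))).
  by rewrite sumr_const -[leRHS]/(1%:R) ler_nat.
have SzE : `|S z| ^+ 2 = #|B|%:R.
  rewrite linear_sum -big_filter.
  set s := [seq _ <- _ | _].
  have os : orthonormal_on (dot := dot) (fun k : 'I_n.+2 => S (g (n, val k))) s.
    move=> k l; rewrite !mem_filter => /andP[/asboolP Jk _] /andP[/asboolP Jl _].
    by rewrite oS //; congr _%:R; congr nat_of_bool; apply/eqP/eqP => [[/val_inj]|->].
  have us : uniq s by rewrite filter_uniq // index_enum_uniq.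
  have -> : \sum_(k <- s) S (g (n, val k)) = \sum_(k <- s) 1 *: S (g (n, val k)).
    by apply: eq_bigr => k _; rewrite scale1r.
  rewrite (norm_combination thetaE dotE (fun=> 1) us os).
  under eq_bigr do rewrite normr1 expr1n.
  by rewrite big_filter sumr_const.
apply: (@le_trans _ _ (#|B|%:R)); first by rewrite ler_nat.
rewrite -SzE ler_pXn2r ?nnegrE //.
by apply: le_trans (boundS _) _; rewrite -[leRHS]mulr1 ler_wpM2l.
Qed.

End Blocks.
End NoRieszSubfamily.

(** * The two scalar fields *)

(** The bound M of riesz_bound_blocks would make every natural number at most
    M^2, against the Archimedean property. *)
Lemma exists_frame_no_riesz (R : realType) (K : numFieldType)
    (theta : {rmorphism K -> K}) (iota : {rmorphism R -> K}) (re : K -> R)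
    (H : completeNormedModType K) (dot : {dot H for theta}) :
  (forall a, a * theta a = `|a| ^+ 2) ->
  {mono iota : r s / r <= s} -> (forall a, 0 <= a -> iota (re a) = a) ->
  induces_norm dot -> infinite_dimensional H -> separable H ->
  exists (I : countType) (f : I -> H),
    [/\ frame re dot f, forall i, `|f i| = 1
      & forall J : set I, ~ riesz_basis dot (fun j : J => f (\val j))].
Proof.
move=> thetaE iota_le reK dotE Hinf Hsep.
have [e [oe approx_e]] := orthonormal_basis_pairs thetaE dotE Hsep Hinf.
have ou := block_dir_orthonormal thetaE dotE oe.
have half := coef_block_dir_half thetaE dotE oe.
exists (nat + nat * nat)%type, (deflated_frame (dot := dot) e (block_dir e)); split.
- exact: (deflated_frame_frame thetaE iota_le reK dotE oe ou approx_e half).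
- exact: (deflated_frame_norm dotE oe ou half).
move=> J /(riesz_bound_blocks thetaE dotE oe)[M M0 Mge].
have Mle n : n.+1%:R <= (re M) ^+ 2.
  by rewrite -iota_le rmorph_nat rmorphXn reK.
have := archi_boundP (sqr_ge0 (re M)).
by apply/negP; rewrite -leNgt; apply: le_trans (Mle _); rewrite ler_nat.
Qed.

Theorem proposition4 (R : realType) :
  (forall (H : completeNormedModType R) (dot : {dot H for (@idfun R)}),
    induces_norm dot -> infinite_dimensional H -> separable H ->
    exists (I : countType) (f : I -> H),
      [/\ frame (@idfun R) dot f,
          forall i, `|f i| = 1
        & forall J : set I, ~ riesz_basis dot (fun j : J => f (\val j))])
  /\
  (forall (H : completeNormedModType R[i]) (dot : {dot H for (@Num.conj R[i])}),
    induces_norm dot -> infinite_dimensional H -> separable H ->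
    exists (I : countType) (f : I -> H),
      [/\ frame (@complex.Re R) dot f,
          forall i, `|f i| = 1
        & forall J : set I, ~ riesz_basis dot (fun j : J => f (\val j))]).
Proof.
split=> H dot; first apply: (@exists_frame_no_riesz R R idfun idfun idfun) => //.
- by move=> a; rewrite -normrX ger0_norm ?sqr_ge0.
- apply: (@exists_frame_no_riesz R R[i] Num.conj (real_complex R) (@complex.Re R)).
  + by move=> a; rewrite -normCK.
  + exact: lecR.
  + by move=> a a0; exact: RRe_real (ger0_real a0).
Qed.
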